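(* Let $G=A+B$ be a finite bipartite graph with $B=\{b_1,\dots,b_n\}$ and let $g\colon B\to\mathbb N$ satisfy $1\le g(b)\le d_G(b)$ for all $b\in B$. Run Algorithm 1 (described in the context). For each $i\in\{1,\dots,g(B)\}$, if step $i$ is performed while processing $b_\ell$ and is the $c$-th augmentation at $b_\ell$, define $g_i\colon B_\ell\to\mathbb N$ by $g_i(b_j)=g(b_j)$ for $j<\ell$ and $g_i(b_\ell)=c$. Then $F_i$ is a minimum $g_i$-quasi-matching of $B_\ell$ in the graph $G_\ell$.
   Context: $G=A+B$ is a bipartite graph with bipartition $(A,B)$; $N(Y)$ is the neighbourhood of $Y$; $d_F(v)$ is the number of edges of $F$ incident with $v$. For a need function $h$ on $Y\subseteq B$, a set $F$ of edges of a bipartite graph $H$ is an $h$-quasi-matching of $Y$ in $H$ if every $v\in Y$ is incident with at least $h(v)$ edges of $F$. For $Y\subseteq B$, $d_F(Y)$ is the sequence of $F$-degrees of the vertices of $N(Y)$ in nonincreasing order; an $h$-quasi-matching $F$ of $Y$ in $H$ is minimum if there is no $h$-quasi-matching $F'$ of $Y$ in $H$ with $d_{F'}(Y)$ lexicographically smaller than $d_F(Y)$. An $F$-alternating path from $a\in A$ to $a'\in A$ is a path in which every internal vertex is incident (in the path) with one edge of $F$ and one not in $F$, the path edge at $a$ is in $F$ and the path edge at $a'$ is not. An $F$-augmenting path is a path $P$ from $b\in B$ to $a\in A$ such that, with $a'$ the neighbour of $b$ on $P$, $ba'\notin F$ and $P-b$ is an $F$-alternating path from $a'$ to $a$ (if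 $a'=a$, $P$ is the edge $ba$). Algorithm 1: $F_0=\emptyset$, $i=0$; for $\ell=1,\dots,n$ in turn, with $B_\ell=\{b_1,\dots,b_\ell\}$ and $G_\ell=G[A\cup B_\ell]$, repeat $g(b_\ell)$ times: increase $i$ by one; let $P_{i-1}$ be an $F_{i-1}$-augmenting path in $G_\ell$ from $b_\ell$ whose end-vertex $a\in A$ minimizes $d_{F_{i-1}}(a)$ among all such paths; set $F_i=F_{i-1}\oplus E(P_{i-1})$. $g(B)=\sum_{b\in B}g(b)$ is the total number of steps. *)

(* Defs.v *)
From mathcomp Require Import all_boot all_order.

Set Implicit Arguments.
Unset Strict Implicit.
Unset Printing Implicit Defensive.

Section BipartiteGraphs.
Variables A B : finType.

(* A simple bipartite graph on the vertex set A + B is given by its edge set, *)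
(* a set of pairs (a, b). Isolated vertices play no role in what follows, so  *)
(* the same type serves for graphs, subgraphs and edge sets F.                *)
Implicit Types (H F : {set A * B}) (s : seq (A + B)).

Definition incident (v : A + B) (e : A * B) : bool :=
  match v with inl a => e.1 == a | inr b => e.2 == b end.

Definition deg F (v : A + B) : nat := #|[set e in F | incident v e]|.

Definition adj H : rel (A + B) := fun u v =>
  match u, v with
  | inl a, inr b | inr b, inl a => (a, b) \in H
  | _, _ => false
  end.

Definition nbhd H (Y : {set B}) : {set A} :=
  [set a | [exists b in Y, (a, b) \in H]].

Definition deg_seq H F (Y : {set B}) : seq nat :=
  sort geq [seq deg F (inl a) | a <- enum (nbhd H Y)].

Definition quasi_matching H (Y : {set B}) (h : B -> nat) F : Prop :=
  F \subset H /\ forall v, v \in Y -> h v <= deg F (inr v).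

Definition minimum_quasi_matching H (Y : {set B}) (h : B -> nat) F : Prop :=
  quasi_matching H Y h F /\
  ~ (exists F', quasi_matching H Y h F' /\
       ((deg_seq H F' Y : seqlexi nat) < (deg_seq H F Y : seqlexi nat))%O).

(* s is the list of all vertices of the path, both ends included. *)
Definition is_path H (u v : A + B) s : bool :=
  if s is x :: p then
    [&& x == u, path (adj H) x p, last x p == v & uniq s]
  else false.

Definition path_edges s : {set A * B} :=
  [set e | ((inl e.1, inr e.2) \in zip s (behead s))
        || ((inr e.2, inl e.1) \in zip s (behead s))].

(* The one-vertex path, with a' = a, is alternating: the last three           *)
(* conditions are then void.                                                  *)
Definition alternating_path H F (a a' : A) s : Prop :=
  [/\ is_path H (inl a) (inl a') s,
      forall v, v \in s -> v != inl a -> v != inl a' ->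
        deg (path_edges s :&: F) v = 1 /\ deg (path_edges s :\: F) v = 1,
      forall e, e \in path_edges s -> incident (inl a) e -> e \in F
    & forall e, e \in path_edges s -> incident (inl a') e -> e \notin F].

Definition augmenting_path H F (b : B) (a : A) s : Prop :=
  is_path H (inr b) (inl a) s /\
  exists (a' : A) (q : seq (A + B)),
    [/\ s = inr b :: inl a' :: q,
        (a', b) \notin F
      & alternating_path H F a' a (inl a' :: q)].

Definition symdiff F F' : {set A * B} := (F :\: F') :|: (F' :\: F).

End BipartiteGraphs.

Section Algorithm.
Variables (A : finType) (n : nat).

(* B = {b_1, ..., b_n} is 'I_n, so that b_l is the ordinal of value l - 1.    *)
Implicit Types (G : {set A * 'I_n}) (g : 'I_n -> nat) (l : 'I_n).

Definition Bupto l : {set 'I_n} := [set j : 'I_n | j <= l].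

Definition Gupto G l : {set A * 'I_n} := [set e in G | e.2 \in Bupto l].

(* Step i (counted from 1) is the c-th augmentation at l: the vertices before *)
(* l account for the first \sum_(j < l) g j steps.                            *)
Definition step_at g (i : nat) l (c : nat) : bool :=
  (1 <= c <= g l) && (i == \sum_(j < n | j < l) g j + c).

(* Only the values on Bupto l matter, where j is either below l or l itself.  *)
Definition need_at g l (c : nat) : 'I_n -> nat :=
  fun j => if j < l then g j else c.

(* F i is the edge set after i steps, and P i the path used in step i + 1.    *)
(* The choice among the admissible paths is left open: every pair of          *)
(* sequences satisfying this predicate is a possible run.                     *)
Definition algorithm1_run G g
    (F : nat -> {set A * 'I_n}) (P : nat -> seq (A + 'I_n)) : Prop :=
  F 0 = set0 /\
  forall i l c, step_at g i l c ->
    exists a : A,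
      [/\ augmenting_path (Gupto G l) (F i.-1) l a (P i.-1),
          forall a' s, augmenting_path (Gupto G l) (F i.-1) l a' s ->
            deg (F i.-1) (inl a) <= deg (F i.-1) (inl a')
        & F i = symdiff (F i.-1) (path_edges (P i.-1))].

End Algorithm.

(* Main.v *)
Require Import Defs.
From mathcomp Require Import all_boot all_order.

(** Orient the edges of F from A to B and those of H outside F from B to A:
    an augmenting path is a simple directed path of this residual digraph.
    Call F balanced if for every j some set X closed under outgoing residual
    arcs contains every vertex of A of degree > j and only vertices of A of
    degree >= j. For such X, any F' with at least the B-degrees of F has at
    least as many edges into X, so the sum of (d(a) - j)^+ is minimal at F for
    every j, and hence the sorted degree sequence is lexicographically minimal.
    Augmenting from b to an end-vertex of minimum degree m preserves balance:
    for j <= m add to X everything reachable from b, so that X contains the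
    whole path; for j > m, X avoids the end-vertex, hence the whole path. In
    both cases reversing the path leaves X closed. *)

Set Implicit Arguments.
Unset Strict Implicit.
Unset Printing Implicit Defensive.

(** * Lexicographic order and excess sums *)

(** Take for [j] the entry of [s] at the first difference: the entries before it contribute equally,
    it and all later entries of [s] are at most [j] and contribute nothing, and the entry of [t]
    there exceeds [j]. *)
Lemma lexi_lt_excess (s t : seq nat) :
  size s = size t -> sorted geq s ->
  ((s : seqlexi nat) < (t : seqlexi nat))%O ->
  exists j, \sum_(x <- s) (x - j) < \sum_(x <- t) (x - j).
Proof.
elim: s t => [|x s IHs] [|y t] //= [size_st] sorted_s.
rewrite ltxi_cons !Order.NatOrder.leEnat => /andP[le_xy /implyP lt_st].
have [le_yx|lt_xy] := leqP y x.
  have [j lt_j] := IHs t size_st (path_sorted sorted_s) (lt_st le_yx).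
  exists j; rewrite !big_cons.
  by rewrite (_ : y = x) ?ltn_add2l //; apply/eqP; rewrite eqn_leq le_yx.
exists x; rewrite !big_cons subnn add0n big1_seq => [|z /andP[_ zs]].
  by apply: leq_trans (leq_addr _ _); rewrite subn_gt0.
have geq_trans : transitive geq by move=> a b c ba ac; apply: leq_trans ac ba.
apply/eqP; rewrite subn_eq0.
by have /allP/(_ z zs) := order_path_min geq_trans sorted_s.
Qed.

(** * Path edges and degrees in symmetric differences *)

Section Residual.
Variables A B : finType.
Implicit Types (H E F : {set A * B}) (X : {set A + B}) (p s : seq (A + B)).

Lemma mem_path_edges s e :
  e \in path_edges s -> (inl e.1 \in s) && (inr e.2 \in s).
Proof.
have mem_zip (u v : A + B) t r : (u, v) \in zip t r -> (u \in t) && (v \in r).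
  elim: t r => [|x t IHt] [|y r] //=; rewrite !inE xpair_eqE.
  by case/orP=> [/andP[-> ->] //|/IHt/andP[-> ->]]; rewrite !orbT.
rewrite inE => /orP[] uv; have /andP[us /mem_behead vs] := mem_zip _ _ _ _ uv;
  by rewrite ?us ?vs.
Qed.

Lemma incident_path_edges s v e :
  e \in path_edges s -> incident v e -> v \in s.
Proof.
by move=> /mem_path_edges/andP[e1 e2]; case: v => [a|b] /= /eqP <-.
Qed.

Lemma path_edges_cons x y p :
  path_edges (x :: y :: p) = path_edges [:: x; y] :|: path_edges (y :: p).
Proof. by apply/setP=> e; rewrite !inE /= orbACA. Qed.

(** With [D] equal to [F] or to its complement, this covers both kinds of path edges. *)
Lemma path_edges_deg_cons x y p (D : {set A * B}) v : v \notin [:: x; y] ->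
  deg (path_edges (x :: y :: p) :&: D) v = deg (path_edges (y :: p) :&: D) v.
Proof.
move=> vxy; apply: eq_card => e.
rewrite [LHS]in_set [RHS]in_set !in_setI path_edges_cons in_setU.
have [ve|] := boolP (incident v e); rewrite ?andbF // !andbT.
case: (boolP (e \in path_edges [:: x; y])) => // /incident_path_edges/(_ ve).
by rewrite (negPf vxy).
Qed.

Lemma path_edgesFE a b p :
  path_edges (inl a :: inr b :: p) = (a, b) |: path_edges (inr b :: p).
Proof.
apply/setP=> -[a' b']; rewrite !inE /= !xpair_eqE /=.
by rewrite !orbA.
Qed.

Lemma path_edgesNE a b p :
  path_edges (inr b :: inl a :: p) = (a, b) |: path_edges (inl a :: p).
Proof.
apply/setP=> -[a' b']; rewrite !inE /= !xpair_eqE /=.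
by rewrite orbCA [(b' == b) && _]andbC.
Qed.

Lemma degU1 e F v : e \notin F -> deg (e |: F) v = incident v e + deg F v.
Proof.
move=> eF; rewrite /deg.
have [ve|ve] := boolP (incident v e).
  rewrite (_ : [set _ in _ | _] = e |: [set e in F | incident v e]).
    by rewrite cardsU1 !inE (negPf eF).
  by apply/setP=> f; rewrite !inE; case: eqP => // ->; rewrite ve.
apply: eq_card => f; rewrite !inE.
by case: eqP => // ->; rewrite (negPf ve) !andbF.
Qed.

Lemma deg0 E v : (forall e, e \in E -> ~~ incident v e) -> deg E v = 0.
Proof.
move=> Ev; apply/eqP; rewrite cards_eq0; apply/eqP/setP=> e; rewrite !inE.
by apply/negP=> /andP[/Ev/negP].
Qed.

Lemma deg_gt0 F v e : e \in F -> incident v e -> 0 < deg F v.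
Proof. by move=> eF ve; apply/card_gt0P; exists e; rewrite inE eF. Qed.

Lemma deg_gt1 F v e f : e \in F -> f \in F -> e != f ->
  incident v e -> incident v f -> 1 < deg F v.
Proof.
move=> eF fF ef ve vf; have <- : #|[set e; f]| = 2 by rewrite cards2 ef.
apply/subset_leq_card/subsetP=> h.
by rewrite !inE => /orP[] /eqP->; rewrite ?eF ?fF.
Qed.

(** Written additively to avoid truncated subtraction. *)
Lemma deg_symdiff F E v :
  deg (symdiff F E) v + deg (E :&: F) v = deg F v + deg (E :\: F) v.
Proof.
pose I := [set e : A * B | incident v e].
have degI D : deg D v = #|D :&: I| by apply: eq_card => e; rewrite !inE.
rewrite !degI setIUl cardsU.
rewrite (_ : (F :\: E) :&: I :&: _ = set0); last first.
  by apply/setP=> e; rewrite !inE; do ![case: (_ \in _)]; rewrite ?andbF.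
rewrite cards0 subn0 addnAC; congr (_ + _).
rewrite -(cardsID E (F :&: I)) addnC.
by congr (_ + _); apply: eq_card => e; rewrite !inE;
  do ![case: (_ \in _)]; rewrite ?andbF ?andbT.
Qed.

(** * Augmenting paths as simple directed paths of the residual digraph *)

Definition residual H F : rel (A + B) := fun u v =>
  match u, v with
  | inl a, inr b => (a, b) \in F
  | inr b, inl a => (a, b) \in H :\: F
  | _, _ => false
  end.

(** An arc of [F] leaves its end in [A] and enters its end in [B]; the other arcs do the opposite. A
    simple path leaves each vertex of [belast x p] once and enters each vertex of [p] once. *)
Lemma residual_path_deg H F x p v :
  path (residual H F) x p -> uniq (x :: p) ->
  deg (path_edges (x :: p) :&: F) v =
    (if v is inl _ then v \in belast x p else v \in p) /\
  deg (path_edges (x :: p) :\: F) v =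
    (if v is inl _ then v \in p else v \in belast x p).
Proof.
have add_mem (c : bool) (u w : A + B) r : w \notin r -> c = (w == u) ->
    (c + (u \in r) = (u == w) || (u \in r) :> nat).
  by rewrite eq_sym => wr ->; case: eqP => // ->; rewrite (negPf wr).
elim: p x => [|y p IHp] x.
  move=> _ _.
  have no_edge (D : {set A * B}) : D \subset path_edges [:: x] -> deg D v = 0.
    by move=> Dx; rewrite deg0 // => e /(subsetP Dx); rewrite inE.
  by rewrite !no_edge ?subsetIl ?subsetDl //; case: (v).
rewrite /= -/(uniq (y :: p)) => /andP[xy Rp] /andP[xNp Up].
have [IH1 IH2] := IHp y Rp Up.
case: x y xy Rp xNp Up IH1 IH2 {IHp} => [a|b] [a'|b'] //= xy Rp xNp Up IH1 IH2.
- have abN : (a, b') \notin path_edges (inr b' :: p) :&: F.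
    by apply: contra xNp; rewrite inE => /andP[/mem_path_edges/andP[]].
  rewrite path_edgesFE setIUl setDUl.
  rewrite (setIidPl _) ?sub1set // (_ : [set _] :\: F = set0); last first.
    by apply/eqP; rewrite setD_eq0 sub1set.
  rewrite set0U degU1 // IH1 IH2.
  case: v {IH1 IH2} => [a0|b0] /=; rewrite !inE; split=> //; last first.
    by apply: add_mem => //; case/andP: Up.
  by apply: add_mem => //; apply: contra xNp => /mem_belast.
- have abN : (a', b) \notin path_edges (inl a' :: p) :\: F.
    by apply: contra xNp; rewrite inE => /andP[_ /mem_path_edges/andP[]].
  move: xy; rewrite inE => /andP[abF _].
  rewrite path_edgesNE setIUl setDUl.
  rewrite (setDidPl _) ?disjoints1 // (_ : [set _] :&: F = set0); last first.
    by apply/eqP; rewrite setI_eq0 disjoints1.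
  rewrite set0U degU1 // IH1 IH2.
  case: v {IH1 IH2} => [a0|b0] /=; rewrite !inE; split=> //.
    by apply: add_mem => //; case/andP: Up.
  by apply: add_mem => //; apply: contra xNp => /mem_belast.
Qed.

(** Makes the minimality of the chosen end-vertex, which ranges over augmenting paths only,
    applicable to everything reachable from [b]. *)
Lemma residual_path_augmenting H F b a p :
  F \subset H -> path (residual H F) (inr b) p -> uniq (inr b :: p) ->
  last (inr b) p = inl a -> augmenting_path H F b a (inr b :: p).
Proof.
move=> FH Rp Up lastp.
have adjp x q : path (residual H F) x q -> path (adj H) x q.
  apply: sub_path => -[u|u] [v|v] //=; first exact: (subsetP FH).
  by rewrite inE => /andP[].
split; first by rewrite /is_path eqxx lastp eqxx Up adjp.
case: p Rp Up lastp => [//|[a'|//] q] /= /andP[a'b Rq] /andP[_ Uq] lastq.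
exists a', q; split=> //; first by move: a'b; rewrite inE => /andP[].
have dq v := residual_path_deg v Rq Uq.
have lastNb : last (inl a') q \notin belast (inl a' : A + B) q.
  by move: Uq; rewrite -/(uniq (inl a' :: q)) lastI rcons_uniq => /andP[].
have mem_cons v :
    (v \in inl a' :: q) = (v == inl a) || (v \in belast (inl a' : A + B) q).
  by rewrite lastI mem_rcons inE lastq.
split=> [|v vq va' va|e eE ae|e eE ae].
- by rewrite /is_path eqxx lastq eqxx adjp.
- have vq' : v \in q by move: vq; rewrite inE (negPf va').
  have vb : v \in belast (inl a' : A + B) q.
    by move: vq; rewrite mem_cons (negPf va).
  by have [-> ->] := dq v; case: v {vq va va'} vq' vb => v -> ->.
(* A path edge at [a'] outside [F] would enter the initial vertex; likewise, in the next case, one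
   of [F] at [a] would leave the last vertex. *)
- apply: contraT => eF; have [_ /= d0] := dq (inl a').
  have := @deg_gt0 (path_edges (inl a' :: q) :\: F) (inl a') e.
  rewrite d0 inE eF eE => /(_ isT ae).
  by case/andP: Uq => /negPf->.
- apply/negP => eF; have [/= d0 _] := dq (inl a).
  have := @deg_gt0 (path_edges (inl a' :: q) :&: F) (inl a) e.
  rewrite d0 inE eF eE => /(_ isT ae).
  by rewrite -lastq (negPf lastNb).
Qed.

(** Two consecutive path edges meet in a vertex with one path edge in [F] and one outside, so they
    differ in type, and the second arc points forward whenever the first does. *)
Lemma alternating_residual H F x y p :
  path (adj H) x (y :: p) -> uniq (x :: y :: p) -> residual H F x y ->
  (forall v, v \in y :: p -> v != last y p ->
    deg (path_edges (x :: y :: p) :&: F) v = 1 /\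
    deg (path_edges (x :: y :: p) :\: F) v = 1) ->
  path (residual H F) x (y :: p).
Proof.
elim: p x y => [|z p IHp] x y; first by rewrite /= => _ _ ->.
move=> /and3P[xy yz Hp] U Rxy alt; apply/andP; split=> //.
have /andP[xNp Up] := U.
have yNp : y \notin z :: p by case/andP: Up.
have Ryz : residual H F y z.
  have [] := alt y (mem_head _ _) _.
    by apply: contraNneq yNp => ->; exact: (mem_last z p).
  have exy : x != z by apply: contraNneq xNp => ->; rewrite !inE eqxx orbT.
  case: x {U alt IHp} xy Rxy {xNp} exy => [a|b];
    case: y yz {Up yNp} => [a'|b'] //;
    case: z {Hp} => [a2|b2] // /= yz xy Rxy exy.
    rewrite inE yz andbT => d1 _; apply/negP=> zF.
    suff: 1 < deg (path_edges [:: inl a, inr b', inl a2 & p] :&: F) (inr b').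
      by rewrite d1.
    apply: (@deg_gt1 _ _ (a, b') (a2, b')) => //=.
    - by rewrite inE path_edgesFE setU11.
    - by rewrite inE path_edgesFE path_edgesNE inE setU11 orbT.
    - by rewrite xpair_eqE eqxx andbT; apply: contraNneq exy => ->.
  move=> _ d1; apply: contraT => zF; move: Rxy; rewrite inE => /andP[xF _].
  suff: 1 < deg (path_edges [:: inr b, inl a', inr b2 & p] :\: F) (inl a').
    by rewrite d1.
  apply: (@deg_gt1 _ _ (a', b) (a', b2)) => //=.
  - by rewrite inE xF path_edgesNE setU11.
  - by rewrite inE zF path_edgesNE path_edgesFE inE setU11 orbT.
  - by rewrite xpair_eqE eqxx /=; apply: contraNneq exy => ->.
apply: IHp => //; first by apply/andP.
move=> v vzp v_last.
(* [v] avoids both ends of the dropped edge, so its degrees survive in the shorter path. *)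
have vxy : v \notin [:: x; y].
  rewrite !inE negb_or; apply/andP; split.
    by apply: contraNneq xNp => <-; rewrite inE vzp orbT.
  by apply: contraNneq yNp => <-.
have := alt v; rewrite inE vzp orbT => /(_ isT v_last).
by rewrite !setDE !(path_edges_deg_cons _ _ vxy).
Qed.

Lemma path_edges_sub H x p : path (adj H) x p -> path_edges (x :: p) \subset H.
Proof.
elim: p x => [|y p IHp] x; first by move=> _; apply/subsetP=> e; rewrite inE.
case/andP=> xy /IHp; case: x xy => [a|b]; case: y {IHp} => [a'|b'] //= xy pH.
  by rewrite path_edgesFE subUset sub1set xy.
by rewrite path_edgesNE subUset sub1set xy.
Qed.

Lemma symdiff_augment_sub H F b a s :
  F \subset H -> augmenting_path H F b a s ->
  symdiff F (path_edges s) \subset H.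
Proof.
move=> FH [+ _]; case: s => // x p /and4P[_ /path_edges_sub pH _ _].
by rewrite subUset !(subset_trans (subsetDl _ _)).
Qed.

Lemma augmenting_path_residual H F b a s :
  augmenting_path H F b a s ->
  exists p, [/\ s = inr b :: p, path (residual H F) (inr b) p,
    uniq (inr b :: p) & last (inr b) p = inl a].
Proof.
move=> [Ps [a' [q [s_eq a'bF [_ alt startF _]]]]]; move: Ps; rewrite {}s_eq.
rewrite /is_path eqxx => /and4P[_ /andP[a'bH Hq] /eqP lastq Uq].
exists (inl a' :: q); split=> //; apply/andP; split.
  by rewrite /= inE a'bF.
case/andP: Uq => _ Uq.
(* If [q] is empty, the path is the single edge from [b] to [a'] and nothing remains. *)
case: q Hq lastq Uq alt startF => // y q Hq lastq Uq alt startF.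
have /andP[a'Nq _] := Uq.
apply: alternating_residual => //.
  case: y Hq Uq alt startF {lastq a'Nq} => [a1|b1] //= Hq Uq alt startF.
  by apply: startF; rewrite ?path_edgesFE ?setU11 //=.
move=> v vq v_last; apply: alt.
- by rewrite inE vq orbT.
- by apply: contraNneq a'Nq => <-.
- by rewrite -lastq.
Qed.

(** An internal vertex exchanges one edge of [F] for one outside, while the first and last path
    edges lie outside [F], so each end gains one. *)
Lemma deg_augment H F b a s v :
  augmenting_path H F b a s ->
  deg (symdiff F (path_edges s)) v = deg F v + (v \in [:: inl a; inr b]).
Proof.
case/augmenting_path_residual=> p [-> Rp Up lastp].
have Ub : uniq (belast (inr b : A + B) p).
  by move: Up; rewrite lastI rcons_uniq => /andP[].
(* Both sides count [v] among all vertices of the path, splitting off the last vertex on the left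
   and the first on the right. *)
have count_v : (v \in belast (inr b : A + B) p) + (v == inl a) =
               (v == inr b) + (v \in p).
  have Up' : uniq p by case/andP: Up.
  rewrite -!count_uniq_mem // ![v == _]eq_sym -lastp.
  have /= := congr1 (count_mem v) (lastI (inr b) p).
  by rewrite -cats1 count_cat /= addn0.
have := deg_symdiff F (path_edges (inr b :: p)) v.
have [-> ->] := residual_path_deg v Rp Up; rewrite !inE.
case: v count_v => [a0|b0] count_v.
  rewrite (_ : inl a0 == inr b = false) // orbF in count_v *.
  rewrite add0n in count_v; rewrite -count_v addnA addnAC => /eqP.
  by rewrite eqn_add2r => /eqP.
rewrite (_ : inr b0 == inl a = false) // orFb in count_v *.
by rewrite addn0 in count_v; rewrite count_v addnA => /eqP;
  rewrite eqn_add2r => /eqP.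
Qed.

(** * Closed sets and balanced edge sets *)

(* Only outgoing arcs: fingraph's [closed] would also forbid incoming ones. *)
Definition residual_closed H F X :=
  forall u v, residual H F u v -> u \in X -> v \in X.

(** A directed path that enters a closed set cannot leave it. *)
Lemma residual_closed_last H F X x p :
  residual_closed H F X -> path (residual H F) x p -> last x p \notin X ->
  forall v, v \in x :: p -> v \notin X.
Proof.
move=> clX; elim: p x => [|y p IHp] x /=.
  by move=> _ xX v; rewrite inE => /eqP->.
case/andP=> xy Rp lastX v; rewrite inE => /orP[/eqP->|]; last exact: IHp.
by apply: contra (IHp _ Rp lastX _ (mem_head _ _)); apply: clX.
Qed.

(** Only arcs along path edges of [s] change, and both ends of each lie on the same side of [X]. *)
Lemma residual_closed_symdiff H F X s :
  residual_closed H F X ->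
  {in s, forall v, v \in X} \/ {in s, forall v, v \notin X} ->
  residual_closed H (symdiff F (path_edges s)) X.
Proof.
move=> clX sX u v Ruv uX.
have endpoints e : e \in path_edges s -> inl e.1 \in X -> inr e.2 \in X.
  by move=> /mem_path_edges/andP[e1 e2]; case: sX => sX;
    [rewrite (sX _ e2)|rewrite (negPf (sX _ e1))].
have endpoints' e : e \in path_edges s -> inr e.2 \in X -> inl e.1 \in X.
  by move=> /mem_path_edges/andP[e1 e2]; case: sX => sX;
    [rewrite (sX _ e1)|rewrite (negPf (sX _ e2))].
case: u v Ruv uX => [a|b] [a'|b'] //= Ruv uX.
  have [/endpoints/(_ uX)//|abE] := boolP ((a, b') \in path_edges s).
  by apply: (clX (inl a)) uX => /=; move: Ruv;
    rewrite in_setU !in_setD (negPf abE) andbF orbF.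
have [/endpoints'/(_ uX)//|abE] := boolP ((a', b) \in path_edges s).
apply: (clX (inr b)) uX => /=; move: Ruv.
by rewrite in_setD in_setU !in_setD (negPf abE) /= andbF orbF.
Qed.

(** Equivalently, no residual path joins a vertex of [A] to one whose degree is smaller by two or
    more: the vertices reachable from degrees above [j] then form such an [X]. *)
Definition balanced H F := forall j, exists X,
  [/\ residual_closed H F X,
      forall a, j < deg F (inl a) -> inl a \in X
    & forall a, inl a \in X -> j <= deg F (inl a)].

Lemma balanced_augment H F b a s :
  F \subset H -> balanced H F -> augmenting_path H F b a s ->
  (forall a' s', augmenting_path H F b a' s' ->
     deg F (inl a) <= deg F (inl a')) ->
  balanced H (symdiff F (path_edges s)).
Proof.
move=> FH balF aug min_a j.
have dega a' : deg (symdiff F (path_edges s)) (inl a') =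
    deg F (inl a') + (a' == a).
  by rewrite (deg_augment _ aug) !inE orbF.
have [p [s_eq Rp Up lastp]] := augmenting_path_residual aug; subst s.
have [X [clX topX lowX]] := balF j.
have [le_ja|lt_aj] := leqP j (deg F (inl a)).
  pose T := [set v | connect (residual H F) (inr b) v].
  have pT : {in inr b :: p, forall v, v \in T}.
    by move=> v vp; rewrite inE; apply: (path_connect Rp).
  have lowT a' : inl a' \in T -> deg F (inl a) <= deg F (inl a').
    (* Shortened to a simple path, the walk is augmenting, so its end competes with [a]. *)
    rewrite inE => /connectP[q Rq]; case/shortenP: Rq => q' Rq' Uq' _ lastq'.
    by apply: (min_a _ (inr b :: q')); apply: residual_path_augmenting.
  exists (X :|: T); split.
  - apply: residual_closed_symdiff.
      move=> u v Ruv; rewrite !inE => /orP[uX|uT].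
        by rewrite (clX _ _ Ruv).
      by rewrite (connect_trans uT (connect1 Ruv)) orbT.
    by left=> v /pT vT; rewrite inE vT orbT.
  - move=> a'; rewrite dega inE; have [->|_] := eqVneq a' a.
      by rewrite [X in _ || X]pT ?orbT // -lastp mem_last.
    by rewrite addn0 => /topX->.
  - move=> a'; rewrite dega inE => /orP[/lowX|/lowT] le.
      exact: leq_trans (leq_addr _ _).
    by apply: leq_trans le_ja (leq_trans le (leq_addr _ _)).
have aX : inl a \notin X by apply: contraL lt_aj => /lowX; rewrite -leqNgt.
exists X; split.
- apply: residual_closed_symdiff => //; right.
  by apply: residual_closed_last clX Rp _; rewrite lastp.
(* The new degree of [a] is at most [j], so [X] may still omit it. *)
- move=> a'; rewrite dega; have [->|_] := eqVneq a' a.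
    by rewrite addn1 ltnS leqNgt lt_aj.
  by rewrite addn0 => /topX.
- by move=> a' /lowX le; rewrite dega (leq_trans le) ?leq_addr.
Qed.

(** Every vertex of [B] without edges of [F] is deleted from [X]. No arc enters such a vertex, so
    [X] stays closed; the new edges all end at such vertices, so they give no arc out of [X]. *)
Lemma balanced_extend H H' F :
  balanced H F ->
  (forall a a' b, (a, b) \in H' :\: H -> (a', b) \notin F) ->
  balanced H' F.
Proof.
move=> balF newF j; have [X [clX topX lowX]] := balF j.
pose covered (v : A + B) :=
  if v is inr b then [exists a : A, (a, b) \in F] else true.
exists [set v in X | covered v]; split.
- move=> u v Ruv; rewrite !inE => /andP[uX cu].
  case: u v Ruv uX cu => [a|b] [a'|b'] //= Ruv uX cu.
    by rewrite (clX (inl a) (inr b') Ruv uX); apply/existsP; exists a.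
  rewrite andbT; apply: clX uX => /=; move: Ruv; rewrite !inE => /andP[-> abH'].
  apply: contraT => abH; have /existsP[a0] := cu.
  by rewrite (negPf (newF a' a0 b _)) // inE abH.
- by move=> a /topX; rewrite inE andbT.
- by move=> a; rewrite inE andbT => /lowX.
Qed.

(** * Minimality of balanced edge sets by double counting *)

Lemma degE F v : deg F v = \sum_a \sum_b ((a, b) \in F) && incident v (a, b).
Proof.
rewrite pair_bigA /deg -sum1_card big_mkcond.
by apply: eq_bigr => -[a b] _; rewrite inE /=; case: ifP.
Qed.

Lemma deg_inl F a : deg F (inl a) = \sum_b ((a, b) \in F).
Proof.
rewrite degE (bigD1 a) //= [X in _ + X]big1 => [|a' a'a].
  by rewrite addn0; apply: eq_bigr => b _; rewrite eqxx andbT.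
by rewrite big1 // => b _; rewrite (negPf a'a) andbF.
Qed.

Lemma deg_inr F b : deg F (inr b) = \sum_a ((a, b) \in F).
Proof.
rewrite degE; apply: eq_bigr => a _; rewrite (bigD1 b) //= big1 => [|b' b'b].
  by rewrite addn0 eqxx andbT.
by rewrite (negPf b'b) andbF.
Qed.

(** Count by the end [b] in [B]. If [b] is outside [X], no edge of [F] joins it to [X]. If [b] is in
    [X], all its edges in [H] to vertices outside [X] belong to [F], so [F'] cannot have more of
    those and has at least as many into [X]. *)
Lemma closed_deg_leq H F F' X :
  F \subset H -> F' \subset H -> residual_closed H F X ->
  (forall b, deg F (inr b) <= deg F' (inr b)) ->
  \sum_(a | inl a \in X) deg F (inl a) <= \sum_(a | inl a \in X) deg F' (inl a).
Proof.
move=> FH F'H clX degB; under eq_bigr do rewrite deg_inl.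
under [leqRHS]eq_bigr do rewrite deg_inl.
rewrite exchange_big [leqRHS]exchange_big /=; apply: leq_sum => b _.
have [bX|bX] := boolP (inr b \in X); last first.
  rewrite big1 // => a aX; apply/eqP; rewrite eqb0.
  by apply: contra bX => abF; apply: (clX (inl a)) aX.
have := degB b; rewrite !deg_inr.
rewrite (bigID (fun a => inl a \in X)).
rewrite [leqRHS](bigID (fun a => inl a \in X)) /=.
(* [F_out] counts the edges of [F] from [b] to vertices outside [X]; adding it to both sides lets
   the degree bound at [b] apply. *)
set F_out := (X in _ + X <= _); rewrite -[in X in _ -> X](leq_add2r F_out).
move/leq_trans; apply; rewrite leq_add2l; apply: leq_sum => a aX.
case: (boolP ((a, b) \in F')) => // abF'; rewrite lt0b.
apply: contraNT aX => abF; apply: (clX (inr b)) bX.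
by rewrite /= inE abF (subsetP F'H).
Qed.

(** Outside [X] the excess of [F] vanishes, and on [X] no truncation occurs, so the total is the
    degree sum over [X] minus [j] per vertex. For [F'] that expression is a lower bound. *)
Lemma balanced_excess_min H F F' j :
  F \subset H -> F' \subset H -> balanced H F ->
  (forall b, deg F (inr b) <= deg F' (inr b)) ->
  \sum_a (deg F (inl a) - j) <= \sum_a (deg F' (inl a) - j).
Proof.
move=> FH F'H balF degB; have [X [clX topX lowX]] := balF j.
have leX := closed_deg_leq FH F'H clX degB.
rewrite (bigID (fun a => inl a \in X)).
rewrite [leqRHS](bigID (fun a => inl a \in X)) /=.
rewrite [X in _ + X <= _]big1 => [|a aX]; last first.
  by apply/eqP; rewrite subn_eq0 leqNgt; apply: contra aX => /topX.
rewrite addn0; apply: leq_trans (leq_addr _ _).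
rewrite -(leq_add2r (\sum_(a | inl a \in X) j)) -!big_split /=.
under eq_bigr => a aX do rewrite subnK ?lowX //.
by apply: (leq_trans leX); apply: leq_sum => a _; rewrite addnC -leq_subLR.
Qed.

(** Vertices of [A] outside [nbhd H Y] have degree 0, whence the condition on [f 0]. *)
Lemma sum_deg_seq H F (Y : {set B}) (f : nat -> nat) :
  F \subset H -> (forall e, e \in H -> e.2 \in Y) -> f 0 = 0 ->
  \sum_(x <- deg_seq H F Y) f x = \sum_a f (deg F (inl a)).
Proof.
move=> FH HY f0; rewrite (perm_big _ (permEl (perm_sort _ _))).
rewrite big_map big_enum /=.
rewrite big_mkcond; apply: eq_bigr => a _; case: ifP => // /negbT aN.
rewrite deg0 // => -[a' b] abF /=; apply: contra aN => /eqP <-.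
have abH := subsetP FH _ abF.
by rewrite inE; apply/existsP; exists b; rewrite abH (HY _ abH).
Qed.

(** As [F] meets every need exactly and has no edge outside [Y], each competitor has at least its
    degree at every vertex of [B]. *)
Lemma balanced_minimum H F (Y : {set B}) (h : B -> nat) :
  F \subset H -> (forall e, e \in H -> e.2 \in Y) -> balanced H F ->
  {in Y, forall b, deg F (inr b) = h b} ->
  minimum_quasi_matching H Y h F.
Proof.
move=> FH HY balF degF; split; first by split=> // b /degF->.
case=> F' [[F'H degF'] lt].
have [||j] := lexi_lt_excess _ _ lt.
- by rewrite !size_sort !size_map.
- by apply: sort_sorted => x y; apply: leq_total.
rewrite !(@sum_deg_seq H) // ltnNge (@balanced_excess_min H) //.
move=> b; have [bY|bY] := boolP (b \in Y); first by rewrite degF ?degF'.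
by rewrite deg0 // => e /(subsetP FH)/HY eY /=; apply: contraNN bY => /eqP <-.
Qed.

End Residual.

(** * The invariant along a run *)

Section Run.
Variables (A : finType) (n : nat) (G : {set A * 'I_n}) (g : 'I_n -> nat).
Variables (F : nat -> {set A * 'I_n}) (P : nat -> seq (A + 'I_n)).
Hypothesis run : algorithm1_run G g F P.
Implicit Types (l b : 'I_n) (E : {set A * 'I_n}).

Definition run_invariant l c E :=
  [/\ E \subset Gupto G l, balanced (Gupto G l) E
    & {in Bupto l, forall b, deg E (inr b) = need_at g l c b}].

Lemma run_invariant_set0 l : l = 0 :> nat -> run_invariant l 0 set0.
Proof.
move=> l0; split; first exact: sub0set.
- move=> j; exists set0; split=> [u v _|a|a]; rewrite ?inE //.
  by rewrite deg0 // => e; rewrite inE.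
- move=> b; rewrite inE l0 leqn0 => /eqP b0.
  by rewrite /need_at b0 l0 deg0 // => e; rewrite inE.
Qed.

Lemma run_invariant_next l l' E :
  l' = l.+1 :> nat -> run_invariant l (g l) E -> run_invariant l' 0 E.
Proof.
move=> l'E [EG balE degE]; split.
- apply: subset_trans EG _; apply/subsetP=> e; rewrite !inE => /andP[-> /= el].
  by rewrite l'E leqW.
(* The new edges all end at [l'], where [E] has no edge yet. *)
- apply: balanced_extend balE _ => a a' b; rewrite !inE.
  move=> /andP[+ /andP[abG _]].
  by rewrite abG /=; apply: contra => /(subsetP EG); rewrite !inE => /andP[].
- move=> b; rewrite inE /need_at l'E leq_eqVlt ltnS => /orP[/eqP bl|bl].
    rewrite bl ltnn deg0 // => e /(subsetP EG); rewrite !inE => /andP[_ el] /=.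
    by apply: contraL el => /eqP->; rewrite bl -ltnNge.
  rewrite bl degE ?inE // /need_at; case: ltnP => // lb.
  by congr g; apply: val_inj; apply/eqP; rewrite eqn_leq bl lb.
Qed.

Lemma run_invariant_augment l c a s E :
  run_invariant l c E -> augmenting_path (Gupto G l) E l a s ->
  (forall a' s', augmenting_path (Gupto G l) E l a' s' ->
     deg E (inl a) <= deg E (inl a')) ->
  run_invariant l c.+1 (symdiff E (path_edges s)).
Proof.
move=> [EG balE degE] aug min_a; split.
- exact: symdiff_augment_sub EG aug.
- exact: balanced_augment EG balE aug min_a.
- move=> b bl; rewrite (deg_augment _ aug) degE // !inE /= /need_at.
  move: bl; rewrite inE leq_eqVlt => /orP[/eqP/val_inj->|bl].
    by rewrite ltnn eqxx addn1.
  rewrite bl (_ : _ == _ = false) ?addn0 //.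
  by apply/eqP=> -[bl']; move: bl; rewrite bl' ltnn.
Qed.

Lemma run_invariant_iter l c :
  run_invariant l 0 (F (\sum_(j < n | j < l) g j)) -> c <= g l ->
  run_invariant l c (F (\sum_(j < n | j < l) g j + c)).
Proof.
move=> start; elim: c => [_|c IHc cg]; first by rewrite addn0.
have [_ step] := run.
have [|a [aug min_a ->]] := step (\sum_(j < n | j < l) g j + c.+1) l c.+1.
  by rewrite /step_at cg eqxx.
rewrite addnS /= in aug min_a *.
exact: run_invariant_augment (IHc (ltnW cg)) aug min_a.
Qed.

Lemma run_invariant_at l c :
  c <= g l -> run_invariant l c (F (\sum_(j < n | j < l) g j + c)).
Proof.
(* Induction on the value of [l], with [c] general since the predecessor is used after its last
   augmentation. *)
move: {2}(l : nat) (erefl (l : nat)) c => m; elim: m l => [|m IHm] l lm c.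
  apply: run_invariant_iter; rewrite big_pred0 => [|j]; last by rewrite lm.
  by have [-> _] := run; apply: run_invariant_set0.
apply: run_invariant_iter.
have mn : m < n by rewrite ltnW // -lm ltn_ord.
have := IHm (Ordinal mn) erefl _ (leqnn _).
(* The last step at the predecessor is the step count at which the processing of [l] starts. *)
rewrite (_ : \sum_(j < n | j < Ordinal mn) _ + _ = \sum_(j < n | j < l) g j).
  exact: run_invariant_next.
rewrite [RHS](bigD1 (Ordinal mn)) /= ?lm // addnC; congr (_ + _).
apply: eq_bigl => j; rewrite ltnS [RHS]andbC -(inj_eq val_inj) /=.
exact: ltn_neqAle.
Qed.

End Run.

Theorem theorem3p2 (A : finType) (n : nat) (G : {set A * 'I_n})
    (g : 'I_n -> nat)
    (hg : forall b : 'I_n, 1 <= g b <= deg G (inr b))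
    (F : nat -> {set A * 'I_n}) (P : nat -> seq (A + 'I_n))
    (hrun : algorithm1_run G g F P)
    (i : nat) (hi : 1 <= i <= \sum_(b < n) g b)
    (l : 'I_n) (c : nat) (hstep : step_at g i l c) :
  minimum_quasi_matching (Gupto G l) (Bupto l) (need_at g l c) (F i).
Proof.
have /andP[/andP[_ cg] /eqP->] := hstep.
have [FG balF degF] := run_invariant_at hrun cg.
by apply: balanced_minimum => // e; rewrite inE => /andP[].
Qed.
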